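(* Let $M\geq2$ be an integer, $\rho>0$ a real number, $\alpha\in(0,1)\cup(1,\infty)$, and $\alpha'=\frac{\alpha}{\alpha-1}$. Consider all pairs $(X,Y)$ where $X$ is a random variable with values in $\{1,\ldots,M\}$ and $Y$ is an arbitrary random variable (side information). The optimal lower bound of the conditional $\rho$-guessing entropy $G_\rho(X|Y)$ in terms of the conditional R\'enyi-Arimoto entropy $H_\alpha(X|Y)$ is given by the parametric curve $\gamma\mapsto(H_\alpha(\gamma),G_\rho(\gamma))$, $\gamma\in I$, defined as follows. (a) When $0<\alpha<1$: $I=(0,\infty)$ and $$G_\rho(\gamma)=1+\gamma^{-1}\Bigl(\frac{\sum_{i=1}^M(1-\gamma+\gamma i^\rho)^{\alpha'}}{\sum_{i=1}^M(1-\gamma+\gamma i^\rho)^{\alpha'-1}}-1\Bigr),$$ $$H_\alpha(\gamma)=\alpha'\log\sum_{i=1}^M(1-\gamma+\gamma i^\rho)^{\alpha'-1}+(1-\alpha')\log\sum_{i=1}^M(1-\gamma+\gamma i^\rho)^{\alpha'}.$$ (b) When $\alpha>1$: $I=(0,1)$ and $$G_\rho(\gamma)=\gamma^{-1}\Bigl(1-\frac{\sum_{i=1}^M(1-\gamma i^\rho)_+^{\alpha'}}{\sum_{i=1}^M(1-\gamma i^\rho)_+^{\alpha'-1}}\Bigr),$$ $$H_\alpha(\gamma)=\alpha'\log\sum_{i=1}^M(1-\gamma i^\rho)_+^{\alpha'-1}+(1-\alpha')\log\sum_{i=1}^M(1-\gamma i^\rho)_+^{\alpha'},$$ where $x_+=\max(x,0)$.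 That is, in each case: (i) for every $(X,Y)$ and every $\gamma\in I$ with $H_\alpha(X|Y)=H_\alpha(\gamma)$, one has $G_\rho(X|Y)\geq G_\rho(\gamma)$; (ii) for every $\gamma\in I$ there is a pair $(X,Y)$ with $H_\alpha(X|Y)=H_\alpha(\gamma)$ and $G_\rho(X|Y)=G_\rho(\gamma)$; (iii) every value in $(0,\log M)$ is of the form $H_\alpha(\gamma)$ for some $\gamma\in I$.
   Context: $\log$ is the logarithm to an arbitrary fixed base greater than $1$. For a pmf $p$ on $\{1,\ldots,M\}$ write $\|p\|_\alpha=\bigl(\sum_i p(i)^\alpha\bigr)^{1/\alpha}$. For an $X$ with values in $\{1,\ldots,M\}$ and pmf $p_X$, the $\rho$-guessing entropy is $G_\rho(X)=\min_\sigma\sum_{i=1}^M p_X(\sigma(i))\,i^\rho$, the minimum being over all permutations $\sigma$ of $\{1,\ldots,M\}$. For an arbitrary (discrete or continuous) random variable $Y$, with $p_{X|Y=y}$ the conditional pmf of $X$ given $Y=y$: the conditional $\rho$-guessing entropy is $G_\rho(X|Y)=\mathbb{E}_y G_\rho(X|Y=y)$, where $G_\rho(X|Y=y)$ is the $\rho$-guessing entropy of $p_{X|Y=y}$, and the conditional R\'enyi-Arimoto entropy of order $\alpha$ is $H_\alpha(X|Y)=-\alpha'\log\mathbb{E}_Y\|p_{X|Y}\|_\alpha$. Expectations are over the distribution of $Y$. *)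

(* Defs.v *)
From mathcomp Require Import all_boot all_order all_algebra all_fingroup.
From mathcomp Require Import all_classical all_reals all_analysis.

Set Implicit Arguments.
Unset Strict Implicit.
Unset Printing Implicit Defensive.
Import Order.TTheory GRing.Theory Num.Theory.
Local Open Scope classical_set_scope.
Local Open Scope ring_scope.

(* A pmf on {1, ..., M} is a function on 'I_M, the ordinal i : 'I_M standing for
   the value i.+1. *)

Definition logb (R : realType) (b x : R) : R := ln x / ln b.

Definition is_pmf (R : realType) (M : nat) (p : 'I_M -> R) : Prop :=
  (forall i, 0 <= p i) /\ \sum_i p i = 1.

Definition alpha_norm (R : realType) (M : nat) (alpha : R) (p : 'I_M -> R) : R :=
  (\sum_i p i `^ alpha) `^ alpha^-1.

Definition guess_cost (R : realType) (M : nat) (rho : R) (p : 'I_M -> R)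
    (s : 'S_M) : R :=
  \sum_(i < M) p (s i) * i.+1%:R `^ rho.

(* The identity permutation is only the default value of the iterated minimum;
   it is itself in the range. *)
Definition guess_entropy (R : realType) (M : nat) (rho : R) (p : 'I_M -> R) : R :=
  \big[Order.min/guess_cost rho p 1%g]_(s : 'S_M) guess_cost rho p s.

(* X takes its values in {1, ..., M}, and q is a version of y |-> p_{X|Y=y}, i.e.
   a regular conditional distribution of X given Y: [q y i] is the conditional
   probability of X = i.+1 given Y = y. Any such X and Y admit a version, unique
   up to a null set of the distribution of Y. *)
Definition is_cond_pmf (R : realType) (M : nat) (d d' : measure_display)
    (Omega : measurableType d) (T : measurableType d') (P : probability Omega R)
    (X : {RV P >-> nat}) (Y : {RV P >-> T}) (q : T -> 'I_M -> R) : Prop :=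
  [/\ forall w, (1 <= X w <= M)%N,
      forall y, is_pmf (q y),
      forall i, measurable_fun [set: T] (fun y => q y i) &
      forall (i : 'I_M) (B : set T), measurable B ->
        P (X @^-1` [set i.+1] `&` Y @^-1` B) =
        (\int[distribution P Y]_(y in B) (q y i)%:E)%E].

(* When q is a version of the conditional pmf, the integrands here and in
   [cond_renyi_entropy] are bounded and measurable, so that the expectations are
   finite and [fine] is harmless; all versions give the same values. *)
Definition cond_guess_entropy (R : realType) (M : nat) (d d' : measure_display)
    (Omega : measurableType d) (T : measurableType d') (P : probability Omega R)
    (rho : R) (Y : {RV P >-> T}) (q : T -> 'I_M -> R) : R :=
  fine 'E_(distribution P Y)[fun y => guess_entropy rho (q y)].

Definition conj_exp (R : realType) (alpha : R) : R := alpha / (alpha - 1).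

Definition cond_renyi_entropy (R : realType) (M : nat) (d d' : measure_display)
    (Omega : measurableType d) (T : measurableType d') (P : probability Omega R)
    (b alpha : R) (Y : {RV P >-> T}) (q : T -> 'I_M -> R) : R :=
  - conj_exp alpha
    * logb b (fine 'E_(distribution P Y)[fun y => alpha_norm alpha (q y)]).

Definition curve_G_lt1 (R : realType) (M : nat) (rho alpha gamma : R) : R :=
  let a' := conj_exp alpha in
  1 + gamma^-1 *
    ((\sum_(i < M) (1 - gamma + gamma * i.+1%:R `^ rho) `^ a')
     / (\sum_(i < M) (1 - gamma + gamma * i.+1%:R `^ rho) `^ (a' - 1)) - 1).

Definition curve_H_lt1 (R : realType) (M : nat) (b rho alpha gamma : R) : R :=
  let a' := conj_exp alpha in
  a' * logb b
    (\sum_(i < M) (1 - gamma + gamma * i.+1%:R `^ rho) `^ (a' - 1))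
  + (1 - a') * logb b
    (\sum_(i < M) (1 - gamma + gamma * i.+1%:R `^ rho) `^ a').

Definition curve_G_gt1 (R : realType) (M : nat) (rho alpha gamma : R) : R :=
  let a' := conj_exp alpha in
  gamma^-1 *
    (1 - (\sum_(i < M) (Num.max (1 - gamma * i.+1%:R `^ rho) 0) `^ a')
         / (\sum_(i < M) (Num.max (1 - gamma * i.+1%:R `^ rho) 0) `^ (a' - 1))).

Definition curve_H_gt1 (R : realType) (M : nat) (b rho alpha gamma : R) : R :=
  let a' := conj_exp alpha in
  a' * logb b
    (\sum_(i < M) (Num.max (1 - gamma * i.+1%:R `^ rho) 0) `^ (a' - 1))
  + (1 - a') * logb b
    (\sum_(i < M) (Num.max (1 - gamma * i.+1%:R `^ rho) 0) `^ a').

Definition optimal_lower_bound (R : realType) (M : nat) (b rho alpha : R)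
    (I : set R) (H G : R -> R) : Prop :=
  [/\ forall (d d' : measure_display) (Omega : measurableType d)
        (T : measurableType d') (P : probability Omega R)
        (X : {RV P >-> nat}) (Y : {RV P >-> T}) (q : T -> 'I_M -> R),
        is_cond_pmf X Y q ->
        forall gamma : R, I gamma ->
          cond_renyi_entropy b alpha Y q = H gamma ->
          G gamma <= cond_guess_entropy rho Y q,
      forall gamma : R, I gamma ->
        exists (d d' : measure_display) (Omega : measurableType d)
          (T : measurableType d') (P : probability Omega R)
          (X : {RV P >-> nat}) (Y : {RV P >-> T}) (q : T -> 'I_M -> R),
          [/\ is_cond_pmf X Y q,
              cond_renyi_entropy b alpha Y q = H gamma &
              cond_guess_entropy rho Y q = G gamma] &
      forall h : R, 0 < h -> h < logb b M%:R ->
        exists2 gamma : R, I gamma & H gamma = h].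

(* Main.v *)
(* Tilting: with weights w_i = 1 - gamma + gamma i^rho (alpha < 1), resp.
   w_i = (1 - gamma i^rho)_+ (alpha > 1), the sum of q_i w_i is affine in the
   guessing cost of q (resp. bounds an affine function of it), while the reverse
   (resp. direct) Hoelder inequality compares it with a multiple of |q|_alpha.
   This gives an affine lower bound on the guessing entropy of q in terms of
   |q|_alpha, with equality at q proportional to w^(alpha' - 1), whose entropies
   are the point of parameter gamma of the curve. An affine bound is preserved
   when taking the expectation over Y, so constant side information is optimal.
   The values of H_alpha
   are reached by the intermediate value theorem. *)
Require Import Defs.
From HB Require Import structures.
From mathcomp Require Import all_boot all_order all_algebra all_fingroup.
From mathcomp Require Import all_classical all_reals all_analysis.
From mathcomp Require Import measurable_realfun ring lra.
Import Order.TTheory GRing.Theory Num.Theory.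
Import numFieldNormedType.Exports.
Set Implicit Arguments.
Unset Strict Implicit.
Unset Printing Implicit Defensive.
Local Open Scope classical_set_scope.
Local Open Scope ring_scope.

(** * Hoelder's inequality and its reverse for finite sums *)

Lemma young_scaled (R : realType) (a b A B p q : R) :
    0 <= a -> 0 <= b -> 0 < A -> 0 < B ->
    0 < p -> 0 < q -> p^-1 + q^-1 = 1 ->
  a * b <= (a `^ p / A / p + b `^ q / B / q) * (A `^ p^-1 * B `^ q^-1).
Proof.
move=> a0 b0 A0 B0 p0 q0 pq.
have A'0 : 0 < A `^ p^-1 by rewrite powR_gt0.
have B'0 : 0 < B `^ q^-1 by rewrite powR_gt0.
rewrite -ler_pdivrMr ?mulr_gt0//.
have scale (u v r : R) : 0 <= u -> 0 < v -> 0 < r ->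
    (u / v `^ r^-1) `^ r = u `^ r / v.
  move=> u0 v0 r0; rewrite powRM ?invr_ge0 ?powR_ge0//; congr (_ * _).
  by rewrite -powRN -powRrM mulNr mulVf ?gt_eqF// powR_inv1// ltW.
(* Young's inequality for [a / A^(1/p)] and [b / B^(1/q)]. With [A] and [B] the power sums of two
   families, summing the bound gives the factor [1/p + 1/q = 1]. *)
have := conjugate_powR (divr_ge0 a0 (ltW A'0)) (divr_ge0 b0 (ltW B'0)) p0 q0 pq.
rewrite (scale _ _ _ a0 A0 p0) (scale _ _ _ b0 B0 q0).
by rewrite mulrACA -invfM.
Qed.

Section hoelder_finite.
Variables (R : realType) (I : finType).
Implicit Types x y : I -> R.

Lemma hoelder_sum x y (p q : R) :
    (forall i, 0 <= x i) -> (forall i, 0 <= y i) ->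
    0 < p -> 0 < q -> p^-1 + q^-1 = 1 ->
  \sum_i x i * y i <=
    (\sum_i x i `^ p) `^ p^-1 * (\sum_i y i `^ q) `^ q^-1.
Proof.
move=> x0 y0 p0 q0 pq.
have sum0 (z : I -> R) (r : R) : 0 < r -> (forall i, 0 <= z i) ->
    \sum_i z i `^ r = 0 -> forall i, z i = 0.
  move=> r0 z0 /eqP; rewrite psumr_eq0 => [/allP z0'|i _]; last exact: powR_ge0.
  move=> i; have := z0' i (mem_index_enum i).
  by rewrite /= powR_eq0 => /andP[/eqP].
(* A vanishing power sum forces its family to be zero, so the left side is 0; otherwise both sums
   are positive and can normalise the terms. *)
have [A0|A0] := eqVneq (\sum_i x i `^ p) 0.
  rewrite big1 ?mulr_ge0 ?powR_ge0// => i _.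
  by rewrite (sum0 x p)// mul0r.
have [B0|B0] := eqVneq (\sum_i y i `^ q) 0.
  rewrite big1 ?mulr_ge0 ?powR_ge0// => i _.
  by rewrite (sum0 y q)// mulr0.
have sum_gt0 (z : I -> R) (r : R) :
    \sum_i z i `^ r != 0 -> 0 < \sum_i z i `^ r.
  by move=> z0; rewrite lt0r z0 sumr_ge0// => i _; exact: powR_ge0.
have le i := young_scaled (x0 i) (y0 i) (sum_gt0 _ _ A0) (sum_gt0 _ _ B0)
  p0 q0 pq.
apply: le_trans (ler_sum _ (fun i _ => le i)) _.
rewrite -mulr_suml big_split/= -!mulr_suml.
by rewrite (divff A0) (divff B0) !mul1r pq mul1r.
Qed.

(* Hoelder's inequality with exponents 1/a and 1/(1 - a), applied to the
   product x^a = (x y)^a y^(-a). *)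
Lemma reverse_hoelder_sum x y (a : R) : 0 < a < 1 ->
    (forall i, 0 <= x i) -> (forall i, 0 < y i) ->
  (\sum_i x i `^ a) `^ a^-1 * (\sum_i y i `^ conj_exp a) `^ (conj_exp a)^-1 <=
    \sum_i x i * y i.
Proof.
move=> /andP[a0 a1] x0 y0.
have a10 : a - 1 < 0 by rewrite subr_lt0.
have xy0 i : 0 <= x i * y i by rewrite mulr_ge0// ltW.
have sxy0 : 0 <= \sum_i x i * y i by exact: sumr_ge0.
(* On an empty index type both sides are 0. Otherwise the power sum of [y] is positive, so that
   powers of it with opposite exponents cancel. *)
have [I0|/card_gt0P[i0 _]] := posnP #|I|.
  have sum0 (F : I -> R) : \sum_i F i = 0.
    by rewrite big1// => i _; have := fintype0 i I0.
  by rewrite !sum0 [0 `^ a^-1]powR0 ?mul0r// invr_eq0 gt_eqF.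
have S0 : 0 < \sum_i y i `^ conj_exp a.
  rewrite (bigD1 i0)//= ltr_pwDl ?powR_gt0//.
  by apply: sumr_ge0 => i _; exact: powR_ge0.
have := @hoelder_sum (fun i => (x i * y i) `^ a) (fun i => y i `^ (- a))
  a^-1 (1 - a)^-1 (fun=> powR_ge0 _ _) (fun=> powR_ge0 _ _).
rewrite !invrK subrKC !invr_gt0 subr_gt0 /= => /(_ a0 a1 erefl).
rewrite [X in X <= _](eq_bigr (fun i => x i `^ a)) => [|i _]; last first.
  rewrite powRM ?(ltW (y0 i))// -mulrA -powRD ?subrr ?powRr0 ?mulr1//.
  by rewrite (gt_eqF (y0 i)) implybT.
rewrite [X in _ <= X `^ _ * _](eq_bigr (fun i => x i * y i)) => [|i _]; last first.
  by rewrite -powRrM mulfV ?gt_eqF// powRr1.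
rewrite [X in _ <= _ * X `^ _](eq_bigr (fun i => y i `^ conj_exp a)) => [|i _];
    last first.
  rewrite -powRrM; congr (_ `^ _).
  by rewrite /conj_exp; field; rewrite lt_eqF// gt_eqF// subr_gt0.
have X0 : 0 <= \sum_i x i `^ a by apply: sumr_ge0 => i _; exact: powR_ge0.
move: (\sum_i x i `^ a) (\sum_i y i `^ _) (\sum_i x i * _) X0 S0 sxy0.
move=> X S T X0 S0 T0 le.
(* Raise to the power [1/a], then multiply by [S^(1/a')]: since [1/a' = -(1 - a)/a], the powers of
   [S] cancel. *)
have le' : X `^ a^-1 <= T * S `^ ((1 - a) / a).
  have := @ge0_ler_powR _ a^-1 _ _ _ _ _ le.
  rewrite !nnegrE invr_ge0 (ltW a0) X0 mulr_ge0 ?powR_ge0//.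
  move=> /(_ isT isT isT) /le_trans; apply.
  by rewrite powRM ?powR_ge0// -!powRrM mulfV ?gt_eqF// powRr1.
apply: le_trans (ler_wpM2r (powR_ge0 S _) le') _.
rewrite -mulrA -powRD; last by rewrite (gt_eqF S0) implybT.
rewrite (_ : _ + _ = 0) ?powRr0 ?mulr1//.
by rewrite /conj_exp; field; rewrite lt_eqF// gt_eqF.
Qed.

End hoelder_finite.

(** * Bounds on norms and guessing entropies of a pmf *)

Section pmf.
Variables (R : realType) (M : nat).
Implicit Types (p : 'I_M -> R) (rho alpha : R).

Lemma pmf_perm p (s : 'S_M) : is_pmf p -> is_pmf (p \o s).
Proof.
move=> [p0 p1]; split=> [i|]; first exact: p0.
by rewrite -p1 [RHS](reindex_inj (@perm_inj _ s)).
Qed.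

Lemma alpha_norm_perm alpha p (s : 'S_M) :
  alpha_norm alpha (p \o s) = alpha_norm alpha p.
Proof.
by rewrite /alpha_norm [in RHS](reindex_inj (@perm_inj _ s)).
Qed.

Lemma pmf_le1 p i : is_pmf p -> p i <= 1.
Proof.
move=> [p0 <-]; rewrite (bigD1 i)//= lerDl; exact: sumr_ge0.
Qed.

Lemma alpha_norm_le alpha p : 0 < alpha -> is_pmf p ->
  alpha_norm alpha p <= M%:R `^ alpha^-1.
Proof.
move=> a0 pp; have p0 := pp.1; rewrite ge0_ler_powR ?nnegrE ?invr_ge0 ?(ltW a0)//.
  by apply: sumr_ge0 => i _; exact: powR_ge0.
have -> : M%:R = \sum_(i < M) 1 :> R by rewrite sumr_const card_ord.
apply: ler_sum => i _.
have <- : 1 `^ alpha = 1 :> R by rewrite powR1.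
by rewrite ge0_ler_powR ?nnegrE ?(ltW a0)// pmf_le1.
Qed.

(** Some entry is at least the average [1/M], and the norm dominates each entry. This keeps the
    arguments of the logarithms positive. *)
Lemma alpha_norm_ge alpha p : 0 < alpha -> is_pmf p ->
  M%:R^-1 <= alpha_norm alpha p.
Proof.
move=> a0 pp; have p0 := pp.1.
have [i pi] : exists i, M%:R^-1 <= p i.
  apply/existsP; rewrite -[X in is_true X]negbK negb_exists.
  apply/negP => /forallP pM.
  have : \sum_i p i < \sum_(i < M) M%:R^-1.
    have M0 : (0 < M)%N.
      rewrite lt0n; apply/eqP => M0; move: pp.2; rewrite big1 => [/eqP|i _].
        by rewrite eq_sym oner_eq0.
      by have := ltn_ord i; rewrite [X in (_ < X)%N]M0.
    apply: ltr_sum => [|i _]; last by rewrite ltNge.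
    by apply/hasP; exists (Ordinal M0); rewrite ?mem_index_enum.
  rewrite sumr_const card_ord -[X in _ < X]mulr_natr pp.2.
  by case: (M) => [|m]; rewrite ?mulr0 ?ltr10// mulVf// ltxx.
apply: (le_trans pi); rewrite -[leLHS](powRr1 (p0 i)) -(mulfV (lt0r_neq0 a0)).
rewrite powRrM ge0_ler_powR ?nnegrE ?invr_ge0 ?powR_ge0 ?(ltW a0)//.
  by apply: sumr_ge0 => j _; exact: powR_ge0.
by rewrite (bigD1 i)//= lerDl sumr_ge0// => j _; exact: powR_ge0.
Qed.

Lemma guess_entropyP rho p x :
  (forall s : 'S_M, x <= guess_cost rho p s) <-> x <= guess_entropy rho p.
Proof.
split=> [le|le s]; first by apply: le_bigmin => // s _; exact: le.
by apply: (le_trans le); exact: bigmin_le.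
Qed.

Lemma guess_entropy_le_id rho p :
  guess_entropy rho p <= \sum_i p i * i.+1%:R `^ rho.
Proof.
apply: (le_trans (bigmin_le_id _ _ _ _)); rewrite /guess_cost le_eqVlt.
by apply/orP; left; apply/eqP; apply: eq_bigr => i _; rewrite perm1.
Qed.

Lemma guess_entropy_ge0 rho p : is_pmf p -> 0 <= guess_entropy rho p.
Proof.
move=> [p0 _]; apply/guess_entropyP => s; apply: sumr_ge0 => i _.
by rewrite mulr_ge0 ?powR_ge0.
Qed.

Lemma guess_entropy_le rho p : is_pmf p ->
  guess_entropy rho p <= \sum_(i < M) i.+1%:R `^ rho.
Proof.
move=> pp; apply: (le_trans (guess_entropy_le_id _ _)).
by apply: ler_sum => i _; rewrite ler_piMl ?powR_ge0// pmf_le1.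
Qed.

End pmf.

(* The pmf for which (reverse) Hoelder's inequality against the weights [w] is an
   equality. *)
Section tilted_pmf.
Variables (R : realType) (M : nat) (alpha : R) (w : 'I_M -> R).
Hypotheses (alpha_gt0 : 0 < alpha) (alpha_neq1 : alpha != 1).
Hypothesis w_ge0 : forall i, 0 <= w i.
Hypothesis w_gt0 : exists i, 0 < w i.

Let a' := conj_exp alpha.

Definition tilted_pmf i : R :=
  w i `^ (conj_exp alpha - 1) / \sum_j w j `^ (conj_exp alpha - 1).

Let am1 : alpha - 1 != 0. Proof. by rewrite subr_eq0. Qed.
Let a0 : alpha != 0. Proof. by rewrite gt_eqF. Qed.

Lemma sum_powR_gt0 (r : R) : 0 < \sum_i w i `^ r.
Proof.
have [i wi] := w_gt0; rewrite (bigD1 i)//= ltr_pwDl ?powR_gt0//.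
by apply: sumr_ge0 => j _; exact: powR_ge0.
Qed.

Lemma tilted_pmfP : is_pmf tilted_pmf.
Proof.
split=> [i|]; first by rewrite divr_ge0 ?powR_ge0// ltW// sum_powR_gt0.
by rewrite -mulr_suml divff// gt_eqF// sum_powR_gt0.
Qed.

Lemma conj_expV : (conj_exp alpha)^-1 = 1 - alpha^-1.
Proof. by rewrite /conj_exp; field; rewrite a0. Qed.

(** Follows from [(a' - 1) * alpha = a']. *)
Lemma alpha_norm_tilted_pmf : alpha_norm alpha tilted_pmf =
  (\sum_i w i `^ a') `^ alpha^-1 / \sum_i w i `^ (a' - 1).
Proof.
rewrite /alpha_norm.
transitivity (((\sum_i w i `^ a') / (\sum_i w i `^ (a' - 1)) `^ alpha) `^ alpha^-1).
  congr (_ `^ _); rewrite mulr_suml; apply: eq_bigr => i _.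
  rewrite powRM ?powR_ge0 ?invr_ge0 ?(ltW (sum_powR_gt0 _))//.
  congr (_ * _).
    by rewrite -powRrM; congr (_ `^ _); rewrite /a' /conj_exp; field.
  by rewrite -powR_inv1 ?(ltW (sum_powR_gt0 _))// -powRrM mulN1r powRN.
rewrite powRM ?invr_ge0 ?powR_ge0 ?(ltW (sum_powR_gt0 _))//; congr (_ * _).
by rewrite -powRN -powRrM mulNr mulfV// powR_inv1// ltW// sum_powR_gt0.
Qed.

Lemma sum_tilted_pmf : \sum_i tilted_pmf i * w i =
  (\sum_i w i `^ a') / \sum_i w i `^ (a' - 1).
Proof.
rewrite mulr_suml; apply: eq_bigr => i _; rewrite mulrAC; congr (_ / _).
(* A nonzero total exponent lets the powers be added even where [w i = 0]. *)
have a'0 : a' != 0 by rewrite mulf_neq0 ?invr_eq0.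
rewrite -{2}(powRr1 (w_ge0 i)) -powRD ?subrK//.
by apply/implyP => /eqP; move/eqP: a'0.
Qed.

(** Equality case for both ranges of [alpha]: the exponents [1/a'] and [1/alpha] of the same power
    sum add up to 1. *)
Lemma hoelder_tilted_pmf :
  (\sum_i w i `^ a') `^ a'^-1 * alpha_norm alpha tilted_pmf =
  \sum_i tilted_pmf i * w i.
Proof.
rewrite alpha_norm_tilted_pmf sum_tilted_pmf mulrA -powRD.
  by rewrite conj_expV subrK powRr1// ltW// sum_powR_gt0.
by rewrite (gt_eqF (sum_powR_gt0 _)) implybT.
Qed.

(** The right side is the formula for the curve; it comes from [a' / alpha = a' - 1]. *)
Lemma renyi_entropy_tilted_pmf b :
  - a' * logb b (alpha_norm alpha tilted_pmf) =
  a' * logb b (\sum_i w i `^ (a' - 1)) + (1 - a') * logb b (\sum_i w i `^ a').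
Proof.
rewrite alpha_norm_tilted_pmf /logb ln_div ?posrE ?powR_gt0 ?sum_powR_gt0//.
rewrite ln_powR; move: (ln _) (ln _) (ln _)^-1 => x y z.
by rewrite /a' /conj_exp; field; rewrite am1 a0.
Qed.

End tilted_pmf.

(** * Averaging over the side information *)

Section cond_entropies.
Variables (R : realType) (M : nat) (d d' : measure_display).
Variables (Omega : measurableType d) (T : measurableType d').
Variables (P : probability Omega R) (Y : {RV P >-> T}) (q : T -> 'I_M -> R).
Hypothesis q_pmf : forall y, is_pmf (q y).
Hypothesis q_meas : forall i, measurable_fun [set: T] (fun y => q y i).

Lemma integrable_bounded_distribution (f : T -> R) (C : R) :
    measurable_fun [set: T] f -> (forall y, 0 <= f y <= C) ->
  (distribution P Y).-integrable [set: T] (EFin \o f).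
Proof.
move=> mf f_bd; apply: measurable_bounded_integrable => //.
  by have /= -> := probability_setT (distribution P Y); rewrite ltry.
exists C; split; first exact: num_real.
move=> x Cx y _ /=; have /andP[f0 fC] := f_bd y.
by rewrite ger0_norm// (le_trans fC)// ltW.
Qed.

Lemma alpha_norm_integrable (alpha : R) : 0 < alpha ->
  (distribution P Y).-integrable [set: T] (EFin \o (alpha_norm alpha \o q)).
Proof.
move=> a0; apply: (@integrable_bounded_distribution _ (M%:R `^ alpha^-1)).
  apply: (measurableT_comp (measurable_powR _)).
  apply: measurable_sum => i.
  exact: (measurableT_comp (measurable_powR _)).
by move=> y; rewrite powR_ge0/=; exact: alpha_norm_le.
Qed.

Lemma guess_entropy_integrable (rho : R) :
  (distribution P Y).-integrable [set: T] (EFin \o (guess_entropy rho \o q)).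
Proof.
apply: (@integrable_bounded_distribution _ (\sum_(i < M) i.+1%:R `^ rho)).
  have mc s : measurable_fun [set: T] (fun y => guess_cost rho (q y) s).
    by apply: measurable_sum => i; apply: measurable_funM.
  rewrite /guess_entropy /=.
  elim: (index_enum _) => [|s r ih].
    by under eq_fun do rewrite /= big_nil; exact: mc.
  under eq_fun do rewrite /= big_cons.
  exact: measurable_minr.
by move=> y; rewrite guess_entropy_ge0//=; exact: guess_entropy_le.
Qed.

(** Linearity and monotonicity of the integral. The slope [k] may have either sign: it is positive
    on the curve for [alpha < 1] and negative for [alpha > 1]. *)
Lemma cond_guess_entropy_ge (rho alpha k c : R) : 0 < alpha ->
    (forall p : 'I_M -> R, is_pmf p ->
      k * alpha_norm alpha p + c <= guess_entropy rho p) ->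
  k * fine 'E_(distribution P Y)[fun y => alpha_norm alpha (q y)] + c <=
    cond_guess_entropy rho Y q.
Proof.
move=> a0 le; rewrite /cond_guess_entropy unlock.
have iN := alpha_norm_integrable a0; have iG := guess_entropy_integrable rho.
have ic : (distribution P Y).-integrable [set: T] (EFin \o (fun=> c)).
  exact: finite_measure_integrable_cst.
have ikN : (distribution P Y).-integrable [set: T]
    (EFin \o (fun y => k * alpha_norm alpha (q y))).
  exact: (integrableZl measurableT k iN).
rewrite -[fine _]/(Rintegral _ _ (alpha_norm alpha \o q)).
rewrite -[leRHS]/(Rintegral _ _ (guess_entropy rho \o q)).
rewrite -RintegralZl//.
have -> : c = Rintegral (distribution P Y) [set: T] (fun=> c).
  by rewrite Rintegral_cst//; have /= -> := probability_setT (distribution P Y);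
    rewrite mulr1.
rewrite -RintegralD//; apply: le_Rintegral => // [|y _]; last exact: le.
exact: (integrableD measurableT ikN ic).
Qed.

Lemma expectation_alpha_norm_gt0 (alpha : R) : 0 < alpha -> (0 < M)%N ->
  0 < fine 'E_(distribution P Y)[fun y => alpha_norm alpha (q y)].
Proof.
move=> a0 M0; have M0' : 0 < M%:R^-1 :> R by rewrite invr_gt0 ltr0n.
apply: (lt_le_trans M0').
have -> : M%:R^-1 = Rintegral (distribution P Y) [set: T] (fun=> M%:R^-1) :> R.
  by rewrite Rintegral_cst//; have /= -> := probability_setT (distribution P Y);
    rewrite mulr1.
rewrite unlock -[leRHS]/(Rintegral _ _ (alpha_norm alpha \o q)).
apply: le_Rintegral => //.
- exact: finite_measure_integrable_cst.
- exact: alpha_norm_integrable.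
- by move=> y _; exact: alpha_norm_ge.
Qed.

End cond_entropies.

(** * Realising a pmf with constant side information *)

Section constant_side_information.
Variables (R : realType) (M : nat) (p : 'I_M -> R).
Hypotheses (M_gt0 : (0 < M)%N) (p_pmf : is_pmf p).

Let weight (n : nat) : R := if insub n is Some i then p i else 0.

Let weight_ge0 n : 0 <= weight n.
Proof. by rewrite /weight; case: insubP => // i _ _; exact: p_pmf.1. Qed.

(** The law on [nat] with mass [p i] at [i], counted from 0; [value] below shifts it to start at
    1. *)
Definition pmf_measure :=
  msum (fun n => mscale (NngNum (weight_ge0 n)) (dirac (n : nat))) M.

Let pmf_measureE (A : set nat) :
  pmf_measure A = (\sum_(i < M) p i * (\1_A (i : nat)))%:E.
Proof.
rewrite /pmf_measure/= /msum/= -sumEFin; apply: eq_bigr => i _.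
by rewrite /mscale/= /dirac /weight (valK i).
Qed.

HB.instance Definition _ := Measure.on pmf_measure.

Let pmf_measure_setT : pmf_measure [set: nat] = 1%E.
Proof.
rewrite pmf_measureE (eq_bigr p) ?p_pmf.2// => i _.
by rewrite indicT mulr1.
Qed.

HB.instance Definition _ :=
  Measure_isProbability.Build _ _ _ pmf_measure pmf_measure_setT.

(** [X] must lie between 1 and [M] at every point, so the points beyond [M], of mass 0, are sent to
    1. *)
Let value (w : nat) : nat := if (w < M)%N then w.+1 else 1%N.

Let measurable_value : measurable_fun [set: nat] value.
Proof. by []. Qed.

HB.instance Definition _ := isMeasurableFun.Build _ _ _ _ value measurable_value.

Lemma exists_constant_side_information (b rho alpha : R) :
  exists (d d' : measure_display) (Omega : measurableType d)
    (T : measurableType d') (P : probability Omega R)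
    (X : {RV P >-> nat}) (Y : {RV P >-> T}) (q : T -> 'I_M -> R),
    [/\ is_cond_pmf X Y q,
        cond_renyi_entropy b alpha Y q =
          - conj_exp alpha * logb b (alpha_norm alpha p) &
        cond_guess_entropy rho Y q = guess_entropy rho p].
Proof.
exists _, _, nat, unit, (pmf_measure : probability nat R),
  (value : {mfun nat >-> nat}), (cst tt : {mfun nat >-> unit}), (fun=> p).
split; last 2 first.
- by rewrite /cond_renyi_entropy (expectation_cst _ (alpha_norm alpha p)).
- by rewrite /cond_guess_entropy (expectation_cst _ (guess_entropy rho p)).
split => //.
- by move=> w /=; rewrite /value; case: ifP => //= wM; rewrite wM.
move=> i B mB; rewrite integral_cst//= /distribution /pushforward.
(* As [Y] is constant, its preimage of [B] is everything or empty. *)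
rewrite preimage_cst; case: ifPn => _; last first.
  by rewrite setI0 !measure0 mule0.
rewrite setIT pmf_measure_setT mule1 pmf_measureE; congr (_%:E).
rewrite (bigD1 i)//= big1 ?addr0 => [|j ji].
  by rewrite indicE mem_set ?mulr1//= /value ltn_ord.
rewrite indicE memNset ?mulr0//= /value ltn_ord => -[/val_inj ji'].
by rewrite ji' eqxx in ji.
Qed.

End constant_side_information.

(** * Continuity and intermediate values *)

Section continuity.
Variable R : realType.

Lemma continuous_powR (r x : R) : 0 < x -> {for x, continuous (fun y : R => y `^ r)}.
Proof.
move=> x0; apply/differentiable_continuous/derivable1_diffP.
by apply: derivable_powR; rewrite in_itv/= x0.
Qed.

Lemma continuous_powR_maxr0 (r x : R) : 0 < r ->
  {for x, continuous (fun y : R => Num.max y 0 `^ r)}.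
Proof.
move=> r0; rewrite /prop_for /continuous_at; have [x0|x0] := ltP 0 x.
  apply: (@cvg_trans _ (y `^ r @[y --> x])); last exact: continuous_powR.
  apply: near_eq_cvg; near=> y.
  by rewrite /= max_l// ltW//; near: y; exact: lt_nbhsr.
apply/cvgrPdist_lt => e e0.
(* For [x <= 0] the limit is 0, and [y < e^(1/r)] makes the power smaller than [e]. *)
have d0 : 0 < e `^ r^-1 by rewrite powR_gt0.
near=> y; rewrite powR0 ?gt_eqF// sub0r normrN ger0_norm ?powR_ge0//.
have -> : e = (e `^ r^-1) `^ r by rewrite -powRrM mulVf ?gt_eqF// powRr1// ltW.
apply: gt0_ltr_powR; rewrite ?nnegrE ?le_max ?lexx ?orbT ?(ltW d0)//.
rewrite gt_max d0 andbT; near: y; apply: lt_nbhsl; exact: le_lt_trans d0.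
Unshelve. all: by end_near. Qed.

Lemma continuous_logb_sum (I : finType) (b x : R) (f : I -> R -> R) :
    (forall i, {for x, continuous (f i)}) -> 0 < \sum_i f i x ->
  {for x, continuous (fun y => logb b (\sum_i f i y))}.
Proof.
move=> cf f0; rewrite /prop_for /continuous_at /logb.
have cs : \sum_i f i y @[y --> x] --> \sum_i f i x.
  by apply: cvg_big => [|i _]; [exact: add_continuous|exact: cf].
exact: (cvgM (cvg_comp _ _ cs (@continuous_ln _ _ f0)) (cvg_cst _)).
Qed.

(** The strict inequality at 0 excludes the endpoint 0, which lies outside the parameter interval of
    both curves. *)
Lemma ivt_decreasing_value (H : R -> R) (K h : R) : 0 <= K ->
    (forall x, 0 <= x <= K -> {for x, continuous H}) ->
    H K <= h -> h < H 0 ->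
  exists2 x, 0 < x <= K & H x = h.
Proof.
move=> K0 cH HK H0.
have [||c] := @IVT R H 0 K h K0.
- apply: continuous_in_subspaceT => x; rewrite inE/= in_itv/=; exact: cH.
- by rewrite ge_min HK orbT le_max (ltW H0).
rewrite in_itv/= le_eqVlt => /andP[/predU1P[<-|c0] cK] Hc.
  by rewrite -Hc ltxx in H0.
by exists c => //; rewrite c0.
Qed.

End continuity.

(** * Reduction to affine bounds on single pmfs *)

(** For each [g], an affine function of the norm with slope [k g] and intercept [c g] bounds the
    guessing entropy from below and is attained at [p g]. The upper bound on the entropy of [p g]
    can come from the identity permutation alone, so [p g] need not be shown decreasing. *)
Lemma optimal_lower_boundI (R : realType) (M : nat) (b rho alpha : R)
    (I : set R) (H G k c : R -> R) (p : R -> 'I_M -> R) :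
    1 < b -> (0 < M)%N -> 0 < alpha -> alpha != 1 ->
    (forall g, I g -> is_pmf (p g)) ->
    (forall g, I g -> H g = - conj_exp alpha * logb b (alpha_norm alpha (p g))) ->
    (forall g, I g -> G g = k g * alpha_norm alpha (p g) + c g) ->
    (forall g, I g -> guess_entropy rho (p g) <= G g) ->
    (forall g q, I g -> is_pmf q ->
      k g * alpha_norm alpha q + c g <= @guess_entropy R M rho q) ->
    (forall h, 0 < h -> h < logb b M%:R -> exists2 g, I g & H g = h) ->
  optimal_lower_bound M b rho alpha I H G.
Proof.
move=> b1 M0 a0 a1 p_pmf HE GE Gp tangent surj; split => //.
- move=> d d' Omega T P X Y q [_ q_pmf q_meas _] g Ig.
  rewrite HE// GE// /cond_renyi_entropy.
  have lnb0 : ln b != 0 by rewrite gt_eqF// ln_gt0.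
  have a'0 : - conj_exp alpha != 0.
    by rewrite oppr_eq0 mulf_neq0 ?invr_eq0 ?subr_eq0// gt_eqF.
  (* Equal Renyi entropies mean that the expected norm equals the norm of [p g]. *)
  move=> /(mulfI a'0)/(divIf lnb0)/ln_inj <-.
  + by apply: cond_guess_entropy_ge => // r r_pmf; exact: tangent.
  + by rewrite posrE expectation_alpha_norm_gt0.
  + rewrite posrE; apply: lt_le_trans (alpha_norm_ge a0 (p_pmf _ Ig)).
    by rewrite invr_gt0 ltr0n.
- move=> g Ig.
  have [d [d' [W [T [P [X [Y [q [XYq Hq Gq]]]]]]]]] :=
    exists_constant_side_information M0 (p_pmf _ Ig) b rho alpha.
  exists d, d', W, T, P, X, Y, q; split=> //; first by rewrite HE.
  apply/eqP; rewrite Gq eq_le Gp//= GE//.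
  by apply: tangent => //; exact: p_pmf.
Qed.

(** Used at parameter 0, where all weights are 1 and the entropy is [log M]. *)
Lemma sum_powR1 (R : realType) (M : nat) (r : R) (w : 'I_M -> R) :
  (forall i, w i = 1) -> \sum_i w i `^ r = M%:R.
Proof.
move=> w1; rewrite (eq_bigr (fun=> 1)) => [|i _]; last by rewrite w1 powR1.
by rewrite sumr_const card_ord.
Qed.

(** * Orders below 1 *)

Section order_lt1.
Variables (R : realType) (M : nat) (b rho alpha : R).
Hypotheses (M_ge2 : (2 <= M)%N) (b_gt1 : 1 < b) (rho_gt0 : 0 < rho).
Hypotheses (alpha01 : 0 < alpha < 1).

Let a' := conj_exp alpha.
Let cost (i : 'I_M) : R := i.+1%:R `^ rho.
Let w (g : R) (i : 'I_M) := 1 - g + g * cost i.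

Let alpha_gt0 : 0 < alpha. Proof. by case/andP: alpha01. Qed.
Let alpha_neq1 : alpha != 1. Proof. by case/andP: alpha01 => _ /lt_eqF->. Qed.
Let M_gt0 : (0 < M)%N. Proof. exact: ltnW. Qed.

Let conj_exp_lt0 : a' < 0.
Proof.
by case/andP: alpha01 => a0 a1; rewrite pmulr_rlt0// invr_lt0 subr_lt0.
Qed.

Let cost_ge1 i : 1 <= cost i.
Proof.
by rewrite -(powRr0 (i.+1%:R : R)) ler_powR ?(ltW rho_gt0)// ler1n.
Qed.

Let w_ge1 g i : 0 <= g -> 1 <= w g i.
Proof. by move=> g0; have := cost_ge1 i; rewrite /w; nra. Qed.

Let w_gt0 g i : 0 <= g -> 0 < w g i.
Proof. by move=> g0; exact: lt_le_trans (w_ge1 _ g0). Qed.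

Let w0E : w 0 =1 fun=> 1.
Proof. by move=> i; rewrite /w subr0 mul0r addr0. Qed.

Let continuous_sum_w g (r : R) : 0 <= g ->
  {for g, continuous (fun x => logb b (\sum_i w x i `^ r))}.
Proof.
move=> g0; apply: continuous_logb_sum => [i|]; last first.
  by apply: sum_powR_gt0; exists (Ordinal M_gt0); exact: w_gt0.
have cw : {for g, continuous (w^~ i)}.
  apply: (cvgD (cvgB (cvg_cst _) cvg_id) (cvgM cvg_id (cvg_cst _))).
exact: cvg_comp cw (@continuous_powR _ _ _ (w_gt0 i g0)).
Qed.

(* The first weight is 1, and the others are at least 1 + g (2^rho - 1), hence
   arbitrarily large, whereas the conjugate exponent is negative. *)
Let curve_H_small (h : R) : 0 < h ->
  exists2 g, 0 <= g & curve_H_lt1 M b rho alpha g <= h.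
Proof.
(* Chosen so that [(1 - a') * M * t / ln b = h]. *)
move=> h0; pose t := h * ln b / ((1 - a') * M%:R).
have lnb : 0 < ln b by exact: ln_gt0.
have a'1 : 0 < 1 - a' by rewrite subr_gt0 (lt_trans conj_exp_lt0).
have M0 : 0 < M%:R :> R by rewrite ltr0n.
have t0 : 0 < t by rewrite divr_gt0 ?mulr_gt0.
have c0 : 0 < (2 : R) `^ rho - 1.
  have e1 : 1 `^ rho = 1 :> R by rewrite powR1.
  rewrite subr_gt0 -[ltLHS]e1; apply: gt0_ltr_powR => //.
  - by rewrite nnegrE.
  - by rewrite nnegrE.
  - by rewrite ltr1n.
(* Makes every weight but the first at least [t^(1/a')], so its [a']-th power is at most [t]. *)
pose g := t `^ a'^-1 / (2 `^ rho - 1).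
have g0 : 0 <= g by rewrite divr_ge0 ?powR_ge0// ltW.
exists g => //; rewrite /curve_H_lt1 -/a'.
have wt i : i != Ordinal M_gt0 -> w g i `^ a' <= t.
  move=> i0; have lew : t `^ a'^-1 <= w g i.
    have ci : 2 `^ rho <= cost i.
      apply: ge0_ler_powR; rewrite ?nnegrE ?(ltW rho_gt0)// ler_nat.
      by rewrite ltnS lt0n; apply: contra i0 => /eqP i0; apply/eqP/val_inj.
    have -> : t `^ a'^-1 = g * (2 `^ rho - 1) by rewrite divfK// gt_eqF.
    by rewrite /w; nra.
  have -> : t = ((t `^ a'^-1) `^ (- a'))^-1.
    by rewrite -powRN opprK -powRrM mulVf ?lt_eqF// powRr1// ltW.
  rewrite -[a' in leLHS]opprK [leLHS]powRN lef_pV2 ?posrE ?powR_gt0 ?w_gt0//.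
  apply: ge0_ler_powR => //; first by rewrite oppr_ge0 ltW.
  - by rewrite nnegrE powR_ge0.
  - by rewrite nnegrE ltW ?w_gt0.
have w0 : w g (Ordinal M_gt0) = 1.
  by rewrite /w /cost powR1 mulr1 subrK.
have S1 : 1 <= \sum_i w g i `^ (a' - 1).
  rewrite (bigD1 (Ordinal M_gt0))//= w0 powR1 lerDl sumr_ge0// => i _.
  exact: powR_ge0.
have S2 : \sum_i w g i `^ a' <= 1 + M%:R * t.
  rewrite (bigD1 (Ordinal M_gt0))//= w0 powR1 lerD2l.
  apply: (@le_trans _ _ (\sum_(i < M) t)).
    rewrite [leRHS](bigD1 (Ordinal M_gt0))//= -[leLHS]add0r.
    by apply: lerD; [exact: ltW|exact: ler_sum].
  by rewrite sumr_const card_ord mulr_natl.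
have S2_gt0 : 0 < \sum_i w g i `^ a'.
  rewrite (bigD1 (Ordinal M_gt0))//= w0 powR1 ltr_pwDl// sumr_ge0// => i _.
  exact: powR_ge0.
have lnS2 : ln (\sum_i w g i `^ a') <= M%:R * t.
  apply: le_trans (le_ln1Dx _); last first.
    by rewrite (lt_trans (ltrN10 R))// mulr_gt0.
  by rewrite ler_ln// posrE (lt_le_trans S2_gt0).
(* The first term of the entropy is nonpositive, as [a' < 0] and its sum is at least 1; the second
   is at most [h] by [ln (1 + x) <= x]. *)
rewrite -[leRHS]add0r; apply: lerD.
  rewrite nmulr_rle0// divr_ge0 ?(ltW lnb)//; exact: ln_ge0.
have -> : h = (1 - a') * (M%:R * t / ln b).
  by rewrite /t; field; rewrite !gt_eqF.
by rewrite ler_pM2l// ler_pM2r ?invr_gt0.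
Qed.

Lemma optimal_lower_bound_lt1 :
  optimal_lower_bound M b rho alpha [set gamma : R | 0 < gamma]
    (curve_H_lt1 M b rho alpha) (curve_G_lt1 M rho alpha).
Proof.
have w_pos g : 0 < g -> exists i, 0 < w g i.
  by move=> /ltW g0; exists (Ordinal M_gt0); exact: w_gt0.
have w_ge0 g : 0 < g -> forall i, 0 <= w g i.
  by move=> /ltW g0 i; rewrite ltW ?w_gt0.
have costE g (q : 'I_M -> R) : 0 < g -> is_pmf q ->
    \sum_i q i * cost i = g^-1 * (\sum_i q i * w g i) + (1 - g^-1).
  move=> g0 [_ q1].
  have -> : \sum_i q i * w g i = (1 - g) + g * \sum_i q i * cost i.
    transitivity ((1 - g) * (\sum_i q i) + g * \sum_i q i * cost i).
      rewrite !mulr_sumr -big_split/=.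
      by apply: eq_bigr => i _; rewrite /w; ring.
    by rewrite q1 mulr1.
  by field; rewrite gt_eqF.
(* The constant of the reverse Hoelder inequality against the weights. *)
pose N g := (\sum_i w g i `^ a') `^ a'^-1.
apply: (@optimal_lower_boundI _ _ _ _ _ _ _ _ (fun g => g^-1 * N g)
  (fun g => 1 - g^-1) (fun g => tilted_pmf alpha (w g))) => //.
- by move=> g /= g0; apply: tilted_pmfP; exact: w_pos.
- by move=> g /= g0; rewrite renyi_entropy_tilted_pmf//; exact: w_pos.
- move=> g /= g0; rewrite -mulrA (hoelder_tilted_pmf _ _ (w_ge0 _ g0) (w_pos _ g0))//.
  rewrite (sum_tilted_pmf _ _ (w_ge0 _ g0))//.
  by rewrite /curve_G_lt1; ring.
- move=> g /= g0; apply: (le_trans (guess_entropy_le_id _ _)).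
  rewrite (costE g)//; last by apply: tilted_pmfP; exact: w_pos.
  rewrite (sum_tilted_pmf _ _ (w_ge0 _ g0))//.
  rewrite le_eqVlt; apply/orP; left; apply/eqP; rewrite /curve_G_lt1; ring.
(* A permutation moves onto [q] without changing its norm, so one bound serves all guessing
   orders. *)
- move=> g q /= g0 q_pmf; apply/guess_entropyP => s.
  rewrite /guess_cost (costE g _ g0 (pmf_perm s q_pmf)) lerD2r -mulrA.
  rewrite ler_pM2l ?invr_gt0// -(alpha_norm_perm _ _ s) mulrC.
  apply: reverse_hoelder_sum => // i; first exact: (pmf_perm s q_pmf).1.
  by rewrite w_gt0 ?ltW.
- move=> h h0 hM; have [K K0 HK] := curve_H_small h0.
  have [||x /andP[x0 _] Hx] := ivt_decreasing_value K0 _ HK _.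
  + move=> x /andP[x0 _].
    by apply: (cvgD (cvgM (cvg_cst _) _) (cvgM (cvg_cst _) _));
      exact: continuous_sum_w.
  + rewrite /curve_H_lt1 !(@sum_powR1 _ _ _ (w 0))//.
    by rewrite -mulrDl addrC subrK mul1r.
  by exists x.
Qed.

End order_lt1.

(** * Orders above 1 *)

Section order_gt1.
Variables (R : realType) (M : nat) (b rho alpha : R).
Hypotheses (M_ge2 : (2 <= M)%N) (b_gt1 : 1 < b) (rho_gt0 : 0 < rho).
Hypotheses (alpha_gt1 : 1 < alpha).

Let a' := conj_exp alpha.
Let cost (i : 'I_M) : R := i.+1%:R `^ rho.
Let w (g : R) (i : 'I_M) := Num.max (1 - g * cost i) 0.

Let alpha_gt0 : 0 < alpha. Proof. exact: lt_trans alpha_gt1. Qed.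
Let alpha_neq1 : alpha != 1. Proof. by rewrite gt_eqF. Qed.
Let M_gt0 : (0 < M)%N. Proof. exact: ltnW. Qed.

Let conj_expB1_gt0 : 0 < a' - 1.
Proof.
have -> : a' - 1 = (alpha - 1)^-1.
  by rewrite /a' /conj_exp; field; rewrite subr_eq0.
by rewrite invr_gt0 subr_gt0.
Qed.

Let conj_exp_gt0 : 0 < a'.
Proof. by rewrite -(subrK 1 a') addr_gt0. Qed.

Let cost0 : cost (Ordinal M_gt0) = 1.
Proof. by rewrite /cost powR1. Qed.

Let w_ge0 g i : 0 <= w g i.
Proof. by rewrite /w le_max lexx orbT. Qed.

Let w_ord0 g : g < 1 -> w g (Ordinal M_gt0) = 1 - g.
Proof. by move=> g1; rewrite /w cost0 mulr1 max_l// subr_ge0 ltW. Qed.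

Let w_pos g : g < 1 -> exists i, 0 < w g i.
Proof. by move=> g1; exists (Ordinal M_gt0); rewrite w_ord0// subr_gt0. Qed.

Let w0E i : w 0 i = 1.
Proof. by rewrite /w mul0r subr0 max_l. Qed.

Let continuous_sum_w g (r : R) : g < 1 -> 0 < r ->
  {for g, continuous (fun x => logb b (\sum_i w x i `^ r))}.
Proof.
move=> g1 r0; apply: continuous_logb_sum => [i|]; last first.
  by apply: sum_powR_gt0; exact: w_pos.
have cw : {for g, continuous (fun x : R => 1 - x * cost i)}.
  apply: (cvgB (cvg_cst _) (cvgM cvg_id (cvg_cst _))).
exact: cvg_comp cw (@continuous_powR_maxr0 _ _ _ r0).
Qed.

(* At g = 2^-rho all the weights but the first one vanish. *)
Let curve_H_zero : exists2 g, 0 <= g < 1 & curve_H_gt1 M b rho alpha g = 0.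
Proof.
pose g : R := (2 `^ rho)^-1.
have c1 : 1 < (2 : R) `^ rho.
  have e1 : 1 `^ rho = 1 :> R by rewrite powR1.
  rewrite -[ltLHS]e1; apply: gt0_ltr_powR => //.
  - by rewrite nnegrE.
  - by rewrite nnegrE.
  - by rewrite ltr1n.
have c0 : 0 < (2 : R) `^ rho by exact: lt_trans c1.
have g0 : 0 <= g by rewrite invr_ge0 ltW.
have g1 : g < 1 by rewrite invf_lt1.
exists g; first by rewrite g0.
have wi i : i != Ordinal M_gt0 -> w g i = 0.
  move=> i0; rewrite /w max_r// subr_le0.
  have ci : 2 `^ rho <= cost i.
    apply: ge0_ler_powR; rewrite ?nnegrE ?(ltW rho_gt0)// ler_nat.
    by rewrite ltnS lt0n; apply: contra i0 => /eqP i0; apply/eqP/val_inj.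
  by rewrite -(mulVf (lt0r_neq0 c0)) ler_wpM2l.
have sumE r : 0 < r -> \sum_i w g i `^ r = (1 - g) `^ r.
  move=> r0; rewrite (bigD1 (Ordinal M_gt0))//= w_ord0// big1 ?addr0// => i i0.
  by rewrite wi// powR0// gt_eqF.
(* With a single nonzero weight the two terms cancel. *)
rewrite /curve_H_gt1 -/a' !sumE// /logb !ln_powR; ring.
Qed.

Lemma optimal_lower_bound_gt1 :
  optimal_lower_bound M b rho alpha [set gamma : R | 0 < gamma < 1]
    (curve_H_gt1 M b rho alpha) (curve_G_gt1 M rho alpha).
Proof.
have costE g (q : 'I_M -> R) : 0 < g -> is_pmf q ->
    \sum_i q i * cost i = g^-1 * (1 - \sum_i q i * (1 - g * cost i)).
  move=> g0 [_ q1].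
  have -> : \sum_i q i * (1 - g * cost i) = 1 - g * \sum_i q i * cost i.
    transitivity (\sum_i q i - g * \sum_i q i * cost i).
      rewrite !mulr_sumr -sumrB.
      by apply: eq_bigr => i _; ring.
    by rewrite q1.
  by field; rewrite gt_eqF.
pose N g := (\sum_i w g i `^ a') `^ a'^-1.
apply: (@optimal_lower_boundI _ _ _ _ _ _ _ _ (fun g => - g^-1 * N g)
  (fun g => g^-1) (fun g => tilted_pmf alpha (w g))) => //.
- by move=> g /= /andP[g0 g1]; apply: tilted_pmfP; exact: w_pos.
- by move=> g /= /andP[g0 g1]; rewrite renyi_entropy_tilted_pmf//; exact: w_pos.
- move=> g /= /andP[g0 g1].
  rewrite -mulrA (hoelder_tilted_pmf _ _ (w_ge0 g) (w_pos g1))//.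
  rewrite (sum_tilted_pmf _ _ (w_ge0 g))//.
  by rewrite /curve_G_gt1; ring.
- move=> g /= /andP[g0 g1]; apply: (le_trans (guess_entropy_le_id _ _)).
  rewrite (costE g)//; last by apply: tilted_pmfP; exact: w_pos.
  (* Truncation costs nothing here: where the weight is cut to 0, so is the tilted pmf, because
     [a' - 1 > 0]. *)
  rewrite (eq_bigr (fun i => tilted_pmf alpha (w g) i * w g i)) => [|i _].
    by rewrite (sum_tilted_pmf _ _ (w_ge0 g)).
  have [wi|wi] : w g i = 1 - g * cost i \/ w g i = 0.
    by rewrite /w; case: leP; [right|left].
    by rewrite wi.
  by rewrite /tilted_pmf wi powR0 ?mul0r// gt_eqF.
- move=> g q /= /andP[g0 g1] q_pmf; apply/guess_entropyP => s.
  have qs := pmf_perm s q_pmf.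
  rewrite /guess_cost (costE g _ g0 qs) !mulNr addrC -[X in X - _]mulr1 -mulrA.
  rewrite -mulrBr ler_pM2l ?invr_gt0// lerD2l lerN2 -(alpha_norm_perm _ _ s).
  (* Taking positive parts only increases the sum, which enters the cost with a negative sign. *)
  apply: (@le_trans _ _ (\sum_i (q \o s) i * w g i)).
    by apply: ler_sum => i _; rewrite ler_wpM2l ?qs.1// le_max lexx.
  rewrite mulrC; apply: hoelder_sum => //; first exact: qs.1.
  by rewrite conj_expV// subrKC.
(* The entropy goes from [log M] at 0 to 0 at [K < 1], so every value in between is taken inside the
   open unit interval. *)
- move=> h h0 hM; have [K /andP[K0 K1] HK] := curve_H_zero.
  have [|||x /andP[x0 xK] Hx] :=
      @ivt_decreasing_value _ (curve_H_gt1 M b rho alpha) K h K0.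
  + move=> x /andP[_ xK]; have x1 := le_lt_trans xK K1.
    by apply: (cvgD (cvgM (cvg_cst _) _) (cvgM (cvg_cst _) _));
      exact: continuous_sum_w.
  + by rewrite HK ltW.
  + rewrite /curve_H_gt1 !(@sum_powR1 _ _ _ (w 0))//.
    by rewrite -mulrDl addrC subrK mul1r.
  by exists x => //=; rewrite x0 (le_lt_trans xK).
Qed.

End order_gt1.

Theorem theorem3 (R : realType) (M : nat) (b rho alpha : R)
    (M_ge2 : (2 <= M)%N) (b_gt1 : 1 < b) (rho_gt0 : 0 < rho) :
  (0 < alpha < 1 ->
    optimal_lower_bound M b rho alpha [set gamma : R | 0 < gamma]
      (curve_H_lt1 M b rho alpha) (curve_G_lt1 M rho alpha))
  /\
  (1 < alpha ->
    optimal_lower_bound M b rho alpha [set gamma : R | 0 < gamma < 1]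
      (curve_H_gt1 M b rho alpha) (curve_G_gt1 M rho alpha)).
Proof.
by split=> a1; [exact: optimal_lower_bound_lt1|exact: optimal_lower_bound_gt1].
Qed.
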